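(* Let $M$ be a compact Riemannian manifold with Lebesgue probability measure $m$, and let $f\colon M\to M$ be Borel measurable. Let $0<\alpha\le1$ be fixed. There exists a finite family $\{K_i\}_{1\le i\le p}$ of $\alpha_i$-observable statistical attractors $K_i$ with basins $B(K_i)$ such that: (a) $\bigcup_{i=1}^p B(K_i)$ covers $m$-almost all of $M$. (b) $\alpha_i=\alpha$ for all $i\in\{1,\dots,p\}$ except at most one, say $i_0$, for which $0<\alpha_{i_0}=m(B(K_{i_0}))<\alpha$. (Therefore $m(B(K_i))\ge\alpha$ for all $i\in\{1,\dots,p\}$ with $i\ne i_0$.) (c) For all $1\le i\le p$, the statistical attractor $K_i$ is $\alpha_i$-observable minimal for $f$ restricted to $M\setminus\bigcup_{j=1}^{i-1}B(K_j)$ (where $\bigcup_{j=1}^{0}B(K_j)=\emptyset$).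
   Context: For a nonempty compact set $K\subset M$, its basin of statistical attraction is $$B(K)=\Big\{x\in M:\ \lim_{n\to+\infty}\frac1n\,\#\{0\le j\le n-1:\ \mathrm{dist}(f^j(x),K)<\epsilon\}=1\ \ \forall\,\epsilon>0\Big\}.$$ A nonempty compact set $K$ with $m(B(K))>0$ is called a statistical attractor. For $0<\alpha\le1$, $K$ is $\alpha$-observable if $m(B(K))\ge\alpha$. For a Borel set $M'\subset M$ with $M'\subset f^{-1}(M')$ and $m(M')\ge\alpha$, a nonempty compact set $K\subset M$ is an $\alpha$-observable statistical attractor restricted to $M'$ (or for $f|_{M'}$) if $m(B(K)\cap M')\ge\alpha$. It is $\alpha$-observable minimal restricted to $M'$ (or for $f|_{M'}$) if it satisfies this inequality and no proper nonempty compact subset of $K$ satisfies it.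
   Formalization: In (b), the equality for the exceptional index is α_{i0} = m(B(K_{i0}) \ ⋃_{j<i0} B(K_j)) < α, using the basin restricted as in (c), instead of α_{i0} = m(B(K_{i0})) < α, which is false in general when basins overlap. *)

(* Defs.v *)
From HB Require Import structures.
From mathcomp Require Import all_boot all_order all_algebra.
From mathcomp Require Import all_classical all_reals all_analysis.

Set Implicit Arguments.
Unset Strict Implicit.
Unset Printing Implicit Defensive.

Import Order.TTheory GRing.Theory Num.Theory.
Import numFieldNormedType.Exports.
Local Open Scope classical_set_scope.
Local Open Scope ring_scope.

#[short(type="pointedMetricType")]
HB.structure Definition PointedMetric (K : numDomainType) :=
  {M of Metric K M & isPointed M}.

Notation borel T := (g_sigma_algebraType (@open T)).

(* [C_on k U f]: f is of class C^k on the open set U. *)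
Fixpoint C_on (R : realType) (V W : normedModType R) (k : nat)
    (U : set V) (f : V -> W) : Prop :=
  (forall x, U x -> {for x, continuous f}) /\
  match k with
  | 0%N => True
  | k'.+1 => forall v : V, (forall x, U x -> derivable f x v) /\
                           C_on k' U (fun x => 'D_v f x)
  end.

Definition smooth_on (R : realType) (V W : normedModType R)
    (U : set V) (f : V -> W) : Prop := forall k, C_on k U f.

(* The bilinear form with Gram matrix G; vectors are rows. *)
Definition gram (R : realType) (n : nat) (G : 'M[R]_n) (v w : 'rV[R]_n) : R :=
  (v *m G *m w^T) 0 0.

(* A smooth n-manifold structure without boundary on the metric space M,
   together with a smooth Riemannian metric given by its coefficient matrices
   in the charts.  The functions [chart], [chart_inv] and [metric] are total,
   but only their values on [chart_dom i], resp. on its image, are relevant. *)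
Record riemannian (R : realType) (n : nat) (M : metricType R) := Riemannian {
  chart_idx : Type ;
  chart_dom : chart_idx -> set M ;
  chart : chart_idx -> M -> 'rV[R]_n ;
  chart_inv : chart_idx -> 'rV[R]_n -> M ;
  metric : chart_idx -> 'rV[R]_n -> 'M[R]_n ;
  chart_dom_open : forall i, open (chart_dom i) ;
  chart_dom_cover : forall x, exists i, chart_dom i x ;
  chart_img_open : forall i, open (chart i @` chart_dom i) ;
  chartK : forall i x, chart_dom i x -> chart_inv i (chart i x) = x ;
  chart_continuous : forall i x, chart_dom i x -> {for x, continuous (chart i)} ;
  chart_inv_continuous : forall i y, (chart i @` chart_dom i) y ->
    {for y, continuous (chart_inv i)} ;
  transition_smooth : forall i j,
    smooth_on (chart i @` (chart_dom i `&` chart_dom j))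
              (chart j \o chart_inv i) ;
  metric_smooth : forall i, smooth_on (chart i @` chart_dom i) (metric i) ;
  metric_sym : forall i y, (chart i @` chart_dom i) y ->
    (metric i y)^T = metric i y ;
  metric_pos : forall i y, (chart i @` chart_dom i) y ->
    forall v, v != 0 -> 0 < gram (metric i y) v v ;
  (* the local expressions define one and the same tensor on overlaps *)
  metric_compat : forall i j y,
    (chart i @` (chart_dom i `&` chart_dom j)) y ->
    forall v w, gram (metric i y) v w =
      gram (metric j (chart j (chart_inv i y)))
           ('D_v (chart j \o chart_inv i) y)
           ('D_w (chart j \o chart_inv i) y)
}.

Section riemannian_distance.
Context (R : realType) (n : nat) (M : metricType R) (g : riemannian n M).

(* C^1 curves are parametrized by R and restricted to [0, 1] below.  Since the
   velocity may vanish, every piecewise C^1 curve has a reparametrization of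
   this form, so the infimum defining the distance is the usual one. *)
Definition C1_curve (c : R -> M) : Prop :=
  continuous c /\
  forall (i : chart_idx g) t, chart_dom i (c t) ->
    derivable (chart i \o c) t 1 /\
    {for t, continuous (fun s => 'D_1 (chart i \o c) s)}.

Definition is_speed (c : R -> M) (s : R -> R) : Prop :=
  forall (i : chart_idx g) t, chart_dom i (c t) ->
    s t = Num.sqrt (gram (metric i (chart i (c t)))
                         ('D_1 (chart i \o c) t)
                         ('D_1 (chart i \o c) t)).

Definition curve_lengths (x y : M) : set R :=
  [set l | exists c s, [/\ C1_curve c, c 0 = x, c 1 = y, is_speed c s &
    l = Rintegral lebesgue_measure `[0, 1]%classic s]].

(* M need not be connected; between different components only the
   compatibility with the topology of M is required. *)
Definition riemannian_distance : Prop :=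
  forall x y, curve_lengths x y !=set0 -> mdist x y = inf (curve_lengths x y).

End riemannian_distance.

(* n-dimensional Lebesgue measure, characterized by its values on boxes *)
Definition lebesgue_rV (R : realType) (n : nat)
    (lam : {measure set (borel 'rV[R]_n) -> \bar R}) : Prop :=
  forall a b : 'rV[R]_n, (forall i, a 0 i <= b 0 i) ->
    lam [set x : 'rV[R]_n | forall i, a 0 i <= x 0 i <= b 0 i] =
    (\prod_i (b 0 i - a 0 i))%:E.

(* [m] is the Riemannian volume, in charts sqrt(det g) dx, up to a positive
   constant; for a probability measure m this constant is 1 / vol(M). *)
Definition normalized_volume (R : realType) (n : nat) (M : pointedMetricType R)
    (g : riemannian n M) (m : probability (borel M) R) : Prop :=
  exists (lam : {measure set (borel 'rV[R]_n) -> \bar R}) (c : R),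
    [/\ lebesgue_rV lam, 0 < c &
     forall (i : chart_idx g) (A : set (borel M)),
       measurable A -> A `<=` chart_dom i ->
       m A = (c%:E * \int[lam]_(y in chart i @` A)
                       (Num.sqrt (\det (metric i y)))%:E)%E].

Section attractors.
Context (R : realType) (M : pointedMetricType R).
Variables (m : probability (borel M) R) (f : M -> M).

Definition setdist (x : M) (K : set M) : R := inf [set mdist x y | y in K].

Definition basin (K : set M) : set M :=
  [set x | forall eps : R, 0 < eps ->
    (fun n : nat =>
       #|[pred j : 'I_n | setdist (iter j f x) K < eps]|%:R / n%:R : R)
    @ \oo --> (1 : R)].

(* The basin of K for the restriction of f to M'.  The mass of an exceptional
   attractor has to be measured by this set: its full basin may have mass at
   least alpha because it can meet the basins of the preceding attractors. *)
Definition restricted_basin (M' K : set M) : set M := basin K `&` M'.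

Definition statistical_attractor (K : set M) : Prop :=
  [/\ K !=set0, compact K & (0 < m (basin K))%E].

Definition observable (a : R) (K : set M) : Prop :=
  [/\ 0 < a <= 1, statistical_attractor K & (a%:E <= m (basin K))%E].

Definition observable_in (a : R) (M' K : set M) : Prop :=
  [/\ K !=set0, compact K & (a%:E <= m (restricted_basin M' K))%E].

Definition minimal_observable_in (a : R) (M' K : set M) : Prop :=
  [/\ 0 < a <= 1,
      [/\ measurable (M' : set (borel M)), M' `<=` f @^-1` M'
        & (a%:E <= m M')%E],
      observable_in a M' K
    & forall K' : set M, K' `<` K -> ~ observable_in a M' K'].

End attractors.

Definition remaining (R : realType) (M : pointedMetricType R) (f : M -> M)
    (p : nat) (K : 'I_p -> set M) (i : 'I_p) : set M :=
  ~` \bigcup_(j in [set j : 'I_p | (j < i)%N]) basin f (K j).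

(* Main.v *)
Require Import Defs.
From HB Require Import structures.
From mathcomp Require Import all_boot all_order all_algebra.
From mathcomp Require Import all_classical all_reals all_analysis.
From mathcomp Require Import measurable_realfun.
Set Implicit Arguments.
Unset Strict Implicit.
Unset Printing Implicit Defensive.
Import Order.TTheory GRing.Theory Num.Theory.
Import numFieldNormedType.Exports.
Local Open Scope classical_set_scope.
Local Open Scope ring_scope.

(* If closed sets F n decrease to F in the compact space M, then the intersection
   of the basins of the F n is contained in the basin of F, so "being
   a-observable restricted to M'" survives decreasing countable intersections.
   Minimal observable sets thus exist without Zorn's lemma: start from M and
   delete the members of a countable basis one at a time, whenever observability
   survives the deletion.
   Basins are backward invariant, hence their complements are forward invariant.
   Removing from M' the basin of a set that is minimal for the threshold
   min(alpha, m M') takes away mass at least alpha, or all that is left, so after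
   finitely many steps nothing is left, and only the last threshold can differ
   from alpha. *)

(** * Frequencies and sets of times of density one *)

Section density.
Context {R : realType}.
Implicit Types b : nat -> bool.

Definition freq b (n : nat) : R := #|[pred j : 'I_n | b j]|%:R / n%:R.

Definition density_one b : Prop := freq b @ \oo --> (1 : R).

Lemma freqE b n : freq b n = (\sum_(j < n) (b j)%:R) / n%:R.
Proof.
rewrite /freq -sum1_card natr_sum big_mkcond /=; congr (_ / _).
by apply: eq_bigr => j _; rewrite inE; case: (b j).
Qed.

Lemma freq_le1 b n : freq b n <= 1.
Proof.
(* For [n = 0] the frequency is [0], because [0^-1 = 0]. *)
rewrite /freq; case: n => [|n]; first by rewrite invr0 mulr0.
by rewrite ler_pdivrMr ?ltr0n// mul1r ler_nat -[leqRHS]card_ord max_card.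
Qed.

Lemma density_one_squeeze (u : R^nat) b :
  u @ \oo --> (1 : R) -> (forall n, u n <= freq b n) -> density_one b.
Proof.
move=> u1 ub; apply: (squeeze_cvgr _ u1 (cvg_cst (1 : R))).
by apply: nearW => n; rewrite ub freq_le1.
Qed.

Lemma density_one_sub b b' :
  (forall j, b j -> b' j) -> density_one b -> density_one b'.
Proof.
move=> bb' /density_one_squeeze; apply => n.
rewrite !freqE ler_wpM2r// ler_sum// => j _; rewrite ler_nat.
by move: (bb' j); case: (b j) => // ->.
Qed.

(** Among its first [n] terms the shifted sequence has at most one hit more than [b], so [freq b n]
    is at least the shifted frequency minus [1/n]. Backward invariance of basins rests on this. *)
Lemma density_one_shift b : density_one (fun j => b j.+1) -> density_one b.
Proof.
move=> b1; pose u n := freq (fun j => b j.+1) n - n%:R^-1.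
have u1 : u @ \oo --> (1 : R).
  rewrite -[X in _ --> X]subr0; apply: cvgB => //.
  rewrite -(cvg_shiftn 1); under eq_fun do rewrite addn1.
  exact: cvg_harmonic.
apply: (density_one_squeeze u1) => n; rewrite /u !freqE -[X in _ - X]mul1r -mulrBl.
rewrite ler_wpM2r// lerBlDr.
apply: (@le_trans _ _ (\sum_(j < n.+1) (b j)%:R)).
  by rewrite big_ord_recl lerDr.
by rewrite big_ord_recr/= lerD2l lern1 leq_b1.
Qed.

Lemma density_oneT b : (forall j, b j) -> density_one b.
Proof.
(* The frequency equals [1] only from [n = 1] on, whence the shift of the index. *)
move=> bT; rewrite /density_one -(cvg_shiftn 1).
under eq_fun => n.
  rewrite freqE (eq_bigr (fun=> 1)); last by move=> j _; rewrite bT.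
  rewrite sumr_const card_ord divff ?addn1 ?pnatr_eq0//.
  over.
exact: cvg_cst.
Qed.

(** Testing the tolerances [1/(k+1)] is enough, so the set of convergence is built from measurable
    sets by countable operations. *)
Lemma measurable_cvg_cst d (T : measurableType d) (u : nat -> T -> R) (l : R) :
  (forall n, measurable_fun [set: T] (u n)) ->
  measurable [set x | u ^~ x @ \oo --> l].
Proof.
move=> mu.
have -> : [set x | u ^~ x @ \oo --> l] =
    \bigcap_k \bigcup_N \bigcap_(n in [set n | (N <= n)%N])
      [set x | `|l - u n x| < k.+1%:R^-1].
  apply/seteqP; split => x /=.
    move=> /cvgrPdist_lt ul k _.
    have [|N _ NP] := ul k.+1%:R^-1; first by rewrite invr_gt0.
    by exists N => // n; exact: NP.
  move=> ul; apply/cvgrPdist_lt => e e0.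
  have [k _ /(_ k (leqnn k)) ke] := near_infty_natSinv_lt (PosNum e0).
  have [N _ NP] := ul k I.
  exists N => // n Nn; exact: lt_trans (NP n Nn) ke.
apply: bigcap_measurable => // k _; apply: bigcup_measurable => N _.
apply: bigcap_measurable => [|n _]; first by exists N => /=.
have mh : measurable_fun [set: T] (fun x => `|l - u n x|).
  by apply: measurableT_comp => //; exact: measurable_funB.
have := mh measurableT _ (measurable_itv `]-oo, k.+1%:R^-1[).
by rewrite setTI.
Qed.

Lemma measurable_density_one d (T : measurableType d) (b : nat -> set T) :
  (forall j, measurable (b j)) ->
  measurable [set x | density_one (fun j => x \in b j)].
Proof.
move=> mb; apply: (@measurable_cvg_cst _ _ (fun n x => freq (fun j => x \in b j) n) 1) => n.
have -> : (fun x => freq (fun j => x \in b j) n) =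
    (fun x => (\sum_(j < n) \1_(b j) x) * n%:R^-1).
  by apply/funext => x; rewrite freqE.
apply: measurable_funM => //.
by apply: measurable_sum => j; exact: measurable_indic.
Qed.

End density.

(** * Distance to a nonempty set *)

Section setdist.
Context {R : realType} {M : pointedMetricType R}.
Implicit Types (x : M) (K L : set M).

(** The infimum need not be attained, but a strict bound on it has a witness. Nonemptiness matters:
    the infimum over the empty set is [0] by default. *)
Lemma setdist_ltP x K (r : R) : K !=set0 ->
  setdist x K < r <-> exists2 y, K y & mdist x y < r.
Proof.
move=> [y0 Ky0]; split.
  move=> /inf_lt[|_ [y Ky <-] xyr]; last by exists y.
  by exists (mdist x y0), y0.
move=> [y Ky]; apply: le_lt_trans; apply: ge_inf; last by exists y.
by exists 0 => _ [z _ <-]; exact: mdist_ge0.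
Qed.

Lemma setdistT x : setdist x [set: M] = 0.
Proof.
apply/eqP; rewrite eq_le; apply/andP; split.
  apply: ge_inf; last by exists x => //; rewrite mdistxx.
  by exists 0 => _ [z _ <-]; exact: mdist_ge0.
apply: lb_le_inf; first by exists (mdist x x), x.
by move=> _ [z _ <-]; exact: mdist_ge0.
Qed.

Lemma setdist_anti x K L : K !=set0 -> K `<=` L -> setdist x L <= setdist x K.
Proof.
move=> [y Ky] KL; apply: lb_le_inf; first by exists (mdist x y), y.
move=> _ [z Kz <-]; apply: ge_inf; last by exists z => //; exact: KL.
by exists 0 => _ [w _ <-]; exact: mdist_ge0.
Qed.

Lemma open_setdist_lt K (r : R) : K !=set0 -> open [set x | setdist x K < r].
Proof.
move=> K0; rewrite openE => x /= /(setdist_ltP _ _ K0)[y Ky xyr].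
apply/nbhs_ballP; exists (r - mdist x y); first by rewrite /= subr_gt0.
move=> z; rewrite ballEmdist/= => xzr; apply/setdist_ltP => //; exists y => //.
by rewrite (le_lt_trans (metric_triangle _ x _))// metric_sym -ltrBrDr.
Qed.

End setdist.

(** * Decreasing closed sets and minimal closed sets *)

Lemma compact_bigcap_sub_open (T : topologicalType) (F : (set T)^nat)
    (U : set T) : compact [set: T] -> (forall n, closed (F n)) ->
    {homo F : n p / (n <= p)%N >-> p `<=` n} ->
  open U -> \bigcap_n F n `<=` U -> exists n, F n `<=` U.
Proof.
move=> /compact_near_coveringP cT clF decF oU FU.
(* Compactness in its near-covering form reduces the claim to a local one. Near a point of the
   intersection [U] itself works for all [n]; any other point lies outside some [F N], and the
   complement of [F N] works for all [n >= N]. *)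
have [x _|N _ FN] := cT nat \oo (fun n x => F n x -> U x) _; last first.
  by exists N => x; exact: (FN N (leqnn N)).
have [Fx|] := pselect ((\bigcap_n F n) x).
  exists (U, [set: nat]); last by move=> [y n] [/=].
  by split; [apply: open_nbhs_nbhs; split => //; exact: FU|exact: filterT].
move=> /existsNP[N /not_implyP[_ NFx]].
exists (~` F N, [set n | (N <= n)%N]).
  split; last by exists N.
  by apply: open_nbhs_nbhs; split => //; exact: closed_openC.
by move=> [y n] [/= NFy Nn] /(decF _ _ Nn).
Qed.

Section minimal_closed_set.
Context (T : topologicalType) (P : set T -> Prop).
Variable U : (set T)^nat.

Fixpoint greedy n : set T :=
  if n is n'.+1 then
    if `[< P (greedy n' `\` U n') >] then greedy n' `\` U n' else greedy n'
  else [set: T].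

Hypothesis P_setT : P [set: T].
Hypothesis openU : forall n, open (U n).

Lemma greedyP n : closed (greedy n) /\ P (greedy n).
Proof.
elim: n => [|n [cn Pn]] /=; first by split => //; exact: closedT.
case: ifPn => // /asboolP PnU; split => //.
by apply: closedI => //; exact: open_closedC.
Qed.

Lemma greedy_decr : {homo greedy : n p / (n <= p)%N >-> p `<=` n}.
Proof.
move=> n p /subnKC <-; elim: (p - n)%N => [|k IHk]; first by rewrite addn0.
apply: subset_trans IHk; rewrite addnS /=.
by case: ifP => _; [exact: subDsetl|exact: subset_refl].
Qed.

End minimal_closed_set.

(** Suppose a closed [L] with [P L] misses a point [x] of the greedy intersection. Some basic [V]
    around [x] avoids [L]. At the stage of [V], the current set without [V] still contains [L], so
    [P] holds for it and [V] was deleted, contradicting that [x] survived. *)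
Lemma exists_minimal_closed (T : topologicalType) (P : set T -> Prop) :
    @second_countable T -> P [set: T] ->
    (forall K L, closed K -> closed L -> K `<=` L -> P K -> P L) ->
    (forall F : (set T)^nat, (forall n, closed (F n)) ->
      {homo F : n p / (n <= p)%N >-> p `<=` n} ->
      (forall n, P (F n)) -> P (\bigcap_n F n)) ->
  exists K, [/\ closed K, P K & forall L, closed L -> L `<` K -> ~ P L].
Proof.
move=> [B /countable_injP[h hinj] [Bopen Bbase]] PT Pup Plim.
(* [U n] is the basic set numbered [n] by [h], and empty if there is none. *)
pose U n := \bigcup_(V in B `&` h @^-1` [set n]) V.
have openU n : open (U n).
  by apply: bigcup_open => V [BV _]; exact: Bopen.
have Uh V : B V -> U (h V) = V.
  move=> BV; apply/seteqP; split => [x [W [BW hWV] Wx]|x Vx]; last by exists V.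
  by rewrite -(hinj W V) ?inE.
exists (\bigcap_n greedy P U n); split.
- by apply: closed_bigI => n _; apply: (greedyP _ _ _).1.
- apply: Plim; [by move=> n; apply: (greedyP _ _ _).1|exact: greedy_decr|].
  by move=> n; apply: (greedyP _ _ _).2.
- move=> L cL [LK KL] PL; apply: KL => x Kx; apply: contrapT => NLx.
  have [V [BV Vx] VL] : filter_from [set V | B V /\ V x] id (~` L).
    by apply: Bbase; apply: open_nbhs_nbhs; split => //; exact: closed_openC.
  have := Kx (h V).+1 I; rewrite /= Uh//.
  case: ifPn => [_ []//|/asboolP + _]; apply; apply: Pup PL => //.
    apply: closedI; first by apply: (greedyP _ _ _).1.
    by apply: open_closedC; exact: Bopen.
  by move=> y Ly; split; [exact: LK|move=> /VL].
Qed.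

(** * Basins: monotonicity, invariance, decreasing limits, measurability *)

Section basins.
Context {R : realType} {M : pointedMetricType R}.
Variable f : M -> M.
Implicit Types K L : set M.

Lemma basinE K : basin f K = [set x | forall e : R, 0 < e ->
  density_one (R := R) (fun j => setdist (iter j f x) K < e)].
Proof. by []. Qed.

Lemma basin_setT : basin f [set: M] = [set: M].
Proof.
rewrite basinE; apply/seteqP; split => // x _ e e0.
by apply: density_oneT => j; rewrite setdistT.
Qed.

Lemma subset_basin K L : K !=set0 -> K `<=` L -> basin f K `<=` basin f L.
Proof.
rewrite !basinE => K0 KL x Kx e e0; apply: density_one_sub (Kx e e0) => j.
exact/le_lt_trans/setdist_anti.
Qed.

Lemma preimage_basin K x : basin f K (f x) -> basin f K x.
Proof.
rewrite basinE => Kfx e e0; apply: density_one_shift.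
by apply: density_one_sub (Kfx e e0) => j; rewrite -iterSr.
Qed.

(** By compactness a single [F n] lies within [e/2] of the intersection. Whenever the orbit is
    within [e/2] of that [F n], it is within [e] of the intersection. *)
Lemma bigcap_basin (F : (set M)^nat) : compact [set: M] ->
    (forall n, closed (F n)) -> (forall n, F n !=set0) ->
    {homo F : n p / (n <= p)%N >-> p `<=` n} -> \bigcap_n F n !=set0 ->
  \bigcap_n basin f (F n) `<=` basin f (\bigcap_n F n).
Proof.
move=> cM clF F0 decF FI0 x Fx; rewrite basinE => e e0.
have e20 : 0 < e / 2 by rewrite divr_gt0.
have [|n Fn] := compact_bigcap_sub_open cM clF decF (open_setdist_lt (e / 2) FI0).
  by move=> y FIy; apply/setdist_ltP => //; exists y; rewrite ?mdistxx.
have := Fx n I; rewrite basinE => /(_ _ e20).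
apply: density_one_sub => j /(setdist_ltP _ _ (F0 n))[y Fny xy].
have /(setdist_ltP _ _ FI0)[z FIz yz] := Fn y Fny.
apply/setdist_ltP => //; exists z => //.
rewrite (le_lt_trans (metric_triangle _ y _))//.
by rewrite (splitr e) ltrD.
Qed.

Hypothesis f_borel : measurable_fun [set: borel M] (f : borel M -> borel M).

Lemma measurable_iter j :
  measurable_fun [set: borel M] (iter j f : borel M -> borel M).
Proof.
by elim: j => [|j IHj]; [exact: measurable_id|exact: measurableT_comp IHj].
Qed.

(** The tolerances [1/(k+1)] suffice, and each one imposes density one on visits to an open set
    under Borel iterates. *)
Lemma measurable_basin K : K !=set0 -> measurable (basin f K : set (borel M)).
Proof.
move=> K0.
have -> : basin f K = \bigcap_k [set x : borel M | density_one (R := R)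
    (fun j => x \in iter j f @^-1` [set y | setdist y K < k.+1%:R^-1])].
  rewrite basinE; apply/seteqP; split => x.
    move=> Kx k _; have k0 : (0 : R) < k.+1%:R^-1 by rewrite invr_gt0.
    by apply: density_one_sub (Kx _ k0) => j jK; rewrite inE.
  move=> Kx e e0; have [k _ /(_ k (leqnn k)) ke] := near_infty_natSinv_lt (PosNum e0).
  apply: density_one_sub (Kx k I) => j; rewrite inE => /lt_trans; exact.
apply: bigcap_measurableType => k _.
apply: (@measurable_density_one R _ (borel M)) => j.
rewrite -[X in measurable X]setTI; apply: measurable_iter => //.
by apply: sub_sigma_algebra; exact: open_setdist_lt.
Qed.

End basins.

(** * Existence of minimal observable sets *)

Section minimal_attractor.
Context {R : realType} {M : pointedMetricType R}.
Variables (m : probability (borel M) R) (f : M -> M).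
Hypothesis M_compact : compact [set: M].
Hypothesis f_borel : measurable_fun [set: borel M] (f : borel M -> borel M).

Lemma closedE_compact (K : set M) : closed K <-> compact K.
Proof.
split=> [cK|]; first exact: subclosed_compact cK M_compact _.
exact: compact_closed (@metric_hausdorff _ M).
Qed.

Lemma exists_minimal_observable (a : R) (M' : set M) : 0 < a <= 1 ->
    measurable (M' : set (borel M)) -> M' `<=` f @^-1` M' ->
  (a%:E <= m M')%E -> exists K, minimal_observable_in m f a M' K.
Proof.
move=> a01 mM' fM' aM'.
have mB K : K !=set0 -> measurable (restricted_basin f M' K : set (borel M)).
  by move=> K0; apply: measurableI => //; exact: measurable_basin.
(* Nonemptiness is part of the predicate: with the default distance [0], the empty set would have
   the whole space as its basin. *)
have [||||K [cK [K0 aK] Kmin]] := @exists_minimal_closed M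
  (fun K => K !=set0 /\ (a%:E <= m (restricted_basin f M' K))%E).
- exact: compact_second_countable.
- split; first by exists point.
  by rewrite /restricted_basin basin_setT setTI.
- move=> K L _ _ KL [K0 aK].
  have L0 : L !=set0 by case: K0 => x /KL; exists x.
  split => //; apply: le_trans aK _; apply: le_measure; rewrite ?inE; [exact: mB..|].
  by apply: setSI; exact: subset_basin.
- move=> F clF decF aF.
  have F0 n := (aF n).1.
  have FI0 : \bigcap_n F n !=set0.
    apply/set0P/negP => /eqP FI0.
    (* With the empty set as the open set, an empty intersection would make some [F n] empty. *)
    have [|n] := compact_bigcap_sub_open M_compact clF decF (@open0 M).
      by rewrite FI0.
    by have [x Fx] := F0 n => /(_ x Fx).
  split => //.
  have mBI : measurable (\bigcap_n restricted_basin f M' (F n) : set (borel M)).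
    by apply: bigcap_measurableType => n _; exact: mB.
  apply: (@le_trans _ _ (m (\bigcap_n restricted_basin f M' (F n)))); last first.
    apply: le_measure; rewrite ?inE; [exact: mBI|exact: mB|].
    move=> x Fx; split; last by have [] := Fx 0%N I.
    by apply: bigcap_basin => // n _; have [] := Fx n I.
  (* Continuity from above of the finite measure [m] carries the lower bound [a] to the intersection
     of the restricted basins. *)
  have mcvg : m \o (fun n => restricted_basin f M' (F n)) @ \oo -->
      m (\bigcap_n restricted_basin f M' (F n)).
    apply: nonincreasing_cvg_mu => //.
    + by rewrite (le_lt_trans (probability_le1 m (mB _ (F0 0%N))))// ltry.
    + by move=> n; exact: mB.
    + move=> n p np; apply/subsetPset; apply: setSI; apply: subset_basin => //.
      exact: (decF n p np).
  by apply: cvge_to_ge mcvg _; apply: nearW => n; exact: (aF n).2.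
exists K; split => //; first by split => //; exact/closedE_compact.
by move=> L LK [L0 /closedE_compact cL aL]; exact: (Kmin L).
Qed.

End minimal_attractor.

(** * Exhaustion of the mass by successive removal of basins *)

Section exhaustion.
Context {R : realType} {M : pointedMetricType R}.
Variables (m : probability (borel M) R) (f : M -> M) (alpha : R).
Hypothesis alpha_gt0 : 0 < alpha.
Hypothesis f_borel : measurable_fun [set: borel M] (f : borel M -> borel M).
Variable next : set M -> set M.

(** The cap by the mass of [M'] ensures that [M'] itself meets the threshold, as the existence of a
    minimal set requires. *)
Definition threshold (M' : set M) : R := Num.min alpha (fine (m M')).

Definition rest (i : nat) : set M :=
  iter i (fun M' => M' `\` basin f (next M')) [set: M].

Lemma restE i : rest i = ~` \bigcup_(j in `I_i) basin f (next (rest j)).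
Proof.
elim: i => [|i IHi]; first by rewrite II0 bigcup_set0 setC0.
by rewrite IIS bigcup_setU bigcup_set1 setCU -IHi -setDE.
Qed.

Lemma rest_preimage i : rest i `<=` f @^-1` rest i.
Proof.
rewrite restE => x xB [j ji Bfx]; apply: xB; exists j => //.
exact: preimage_basin.
Qed.

Hypothesis next_neq0 : forall M', next M' !=set0.

Lemma measurable_rest i : measurable (rest i : set (borel M)).
Proof.
elim: i => [|i IHi]; first exact: measurableT.
by apply: measurableD => //; exact: measurable_basin.
Qed.

Let mass i : R := fine (m (rest i)).

Lemma massE i : m (rest i) = (mass i)%:E.
Proof. by rewrite fineK// fin_num_measure//; exact: measurable_rest. Qed.

Lemma mass_ge0 i : 0 <= mass i.
Proof. exact/fine_ge0/measure_ge0. Qed.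

Hypothesis next_observable : forall i, 0 < mass i ->
  ((threshold (rest i))%:E <= m (restricted_basin f (rest i) (next (rest i))))%E.

Lemma mass_succ i : mass i.+1 <= mass i - threshold (rest i).
Proof.
have mB : measurable (basin f (next (rest i)) : set (borel M)).
  exact: measurable_basin.
have mDI : m (rest i) = (m (rest i.+1) +
    m (restricted_basin f (rest i) (next (rest i))))%E.
  rewrite (measureDI m (measurable_rest i) mB); congr (_ + m _)%E.
  by rewrite /restricted_basin setIC.
rewrite lerBrDr -lee_fin EFinD -!massE mDI leeD2l//.
have [|] := ltP 0 (mass i); first exact: next_observable.
(* Once the mass is zero the threshold is at most zero, and the bound is trivial. *)
move=> mi0; apply: le_trans (measure_ge0 m _).
by rewrite lee_fin ge_min; apply/orP; right.
Qed.

(** Each step either has threshold [alpha] and lowers the mass by at least that much, or has the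
    whole remaining mass as threshold and leaves nothing. *)
Lemma mass_le i : mass i <= Num.max 0 (1 - i%:R * alpha).
Proof.
elim: i => [|i IHi].
  rewrite le_max mul0r subr0; apply/orP; right.
  by rewrite -lee_fin -massE probability_le1//; exact: measurable_rest.
apply: le_trans (mass_succ i) _; rewrite /threshold -/(mass i) le_max.
have [mi|mi] := leP alpha (mass i); last by rewrite subrr lexx.
move: IHi; rewrite le_max => /orP[IHi|IHi]; apply/orP; [left|right].
  by rewrite subr_le0 (le_trans IHi)// ltW.
by rewrite -natr1 mulrDl mul1r opprD addrA lerD2r.
Qed.

Lemma mass_eventually0 : exists i, mass i == 0.
Proof.
(* This [i] exceeds [1/alpha], so [1 - i * alpha] is negative and the maximum in [mass_le] is
   [0]. *)
pose i := Num.bound alpha^-1; exists i.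
have i1 : 1 - i%:R * alpha <= 0.
  rewrite subr_le0 -ler_pdivrMr// mul1r ltW// archi_boundP//.
  by rewrite invr_ge0 ltW.
have := mass_le i; rewrite (max_idPl i1) => mi.
by rewrite eq_le mi mass_ge0.
Qed.

End exhaustion.

(** * Assembly of the finite family *)

Theorem theorem1p12 (R : realType) (n : nat) (M : pointedMetricType R)
    (g : riemannian n M) (m : probability (borel M) R) (f : M -> M) (alpha : R)
    (M_compact : compact [set: M])
    (M_distance : riemannian_distance g)
    (m_volume : normalized_volume g m)
    (f_borel : measurable_fun [set: borel M] (f : borel M -> borel M))
    (alpha_range : 0 < alpha <= 1) :
  exists (p : nat) (K : 'I_p -> set M) (a : 'I_p -> R),
    [/\ forall i, observable m f (a i) (K i),
        {ae m, forall x, exists i, basin f (K i) x},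
        [/\ forall i j, a i <> alpha -> a j <> alpha -> i = j,
            forall i, a i <> alpha ->
              0 < a i < alpha /\
              (a i)%:E = m (restricted_basin f (remaining f K i) (K i))
          & forall i, a i = alpha -> (alpha%:E <= m (basin f (K i)))%E]
      & forall i, minimal_observable_in m f (a i) (remaining f K i) (K i)].

Proof.
have [a0 a1] := andP alpha_range.
(* Sets that are not measurable, not forward invariant or of zero mass receive the whole space as a
   default, so that [next] always takes nonempty values. *)
have /choice[next nextP] : forall M' : set M, exists K : set M, K !=set0 /\
    (measurable (M' : set (borel M)) -> M' `<=` f @^-1` M' ->
     0 < fine (m M') ->
     minimal_observable_in m f (threshold m alpha M') M' K).
  move=> M'; have [[mM' [fM' M'0]]|nM'] := pselect (measurable (M' : set (borel M)) /\
    M' `<=` f @^-1` M' /\ 0 < fine (m M')); last first.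
    by exists setT; split; [exists point|move=> *; exfalso; exact: nM'].
  have [||||K Kmin] := @exists_minimal_observable _ _ m f M_compact f_borel
    (threshold m alpha M') M' _ _ _ _.
  - by rewrite lt_min a0 M'0 ge_min a1.
  - exact: mM'.
  - exact: fM'.
  - by rewrite -[leRHS]fineK ?fin_num_measure// lee_fin ge_min lexx orbT.
  by exists K; split => //; have [_ _ []] := Kmin.
have next0 M' : next M' !=set0 := (nextP M').1.
pose S := rest f next.
have mS i : measurable (S i : set (borel M)) by exact: measurable_rest.
have SE i : m (S i) = (fine (m (S i)))%:E by rewrite fineK// fin_num_measure.
have Smin i : 0 < fine (m (S i)) ->
    minimal_observable_in m f (threshold m alpha (S i)) (S i) (next (S i)).
  by move=> Si0; apply: (nextP _).2 => //; exact: rest_preimage.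
have Sobs i : 0 < fine (m (S i)) -> ((threshold m alpha (S i))%:E <=
    m (restricted_basin f (S i) (next (S i))))%E.
  by move=> /Smin[_ _ []].
have S_ex0 : exists i, fine (m (S i)) == 0.
  exact: (mass_eventually0 a0 f_borel next0 Sobs).
have S_succ i := mass_succ f_borel next0 Sobs i.
(* The family stops at the least [p] for which [S p] is null; every earlier [S i] then has positive
   mass. *)
case: (ex_minnP S_ex0) => p /eqP Sp0 p_min.
have S_gt0 (i : 'I_p) : 0 < fine (m (S i)).
  rewrite lt_neqAle fine_ge0// andbT eq_sym; apply/negP => /p_min.
  by rewrite leqNgt ltn_ord.
have remE (i : 'I_p) :
    remaining f (fun i : 'I_p => next (S i)) i = S i.
  rewrite /S restE /remaining; congr (~` _); apply/seteqP; split => x [j ji Bx].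
    by exists j.
  by exists (Ordinal (ltn_trans ji (ltn_ord i))).
have a_lt i : threshold m alpha (S i) <> alpha -> fine (m (S i)) < alpha.
  by rewrite /threshold; case: leP.
(* A threshold other than [alpha] is the entire mass of [S i], so [S i.+1] is null and minimality of
   [p] makes [i] the last index. Hence at most one index is exceptional. *)
have last_ord (i : 'I_p) : threshold m alpha (S i) <> alpha -> i.+1 = p.
  move=> /a_lt ia; apply/eqP; rewrite eqn_leq ltn_ord p_min//.
  rewrite eq_le fine_ge0// andbT (le_trans (S_succ i))// /threshold.
  by rewrite (min_idPr (ltW ia)) subrr.
have le_basin (i : 'I_p) : ((threshold m alpha (S i))%:E <= m (basin f (next (S i))))%E.
  apply: le_trans (Sobs i (S_gt0 i)) _; apply: le_measure; rewrite ?inE.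
  - by apply: measurableI => //; exact: measurable_basin.
  - exact: measurable_basin.
  - by move=> x [].
exists p, (fun i => next (S i)), (fun i => threshold m alpha (S i)); split.
- move=> i; have [t01 _ [_ cK _] _] := Smin i (S_gt0 i).
  split => //; split => //; apply: lt_le_trans (le_basin i).
  by rewrite lte_fin; case/andP: t01.
(* The null set [S p] is exactly the complement of the [p] basins. *)
- exists (S p); split => //; first by rewrite SE Sp0.
  move=> x /= xB; rewrite /S restE => -[j jp Bx].
  by apply: xB; exists (Ordinal jp).
- split.
  + move=> i j /last_ord ip /last_ord jp; apply/val_inj/succn_inj.
    by rewrite ip jp.
  (* Here the threshold is the mass of [S i]. Observability bounds the restricted basin from below
     by it, and inclusion in [S i] bounds it from above. *)
  + move=> i ia; have := Smin i (S_gt0 i) => -[/andP[t0 _] _ _ _].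
    have ialt := a_lt _ ia; have tE : threshold m alpha (S i) = fine (m (S i)).
      exact/min_idPr/ltW.
    rewrite t0 {1}tE ialt; split => //; apply/eqP; rewrite remE eq_le Sobs//=.
    rewrite tE -SE le_measure ?inE//.
      by apply: measurableI => //; exact: measurable_basin.
    by move=> x [].
  + by move=> i ia; have := le_basin i; rewrite ia.
- by move=> i; rewrite remE; exact: Smin.
Qed.
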